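(* Let $n\ge 2$ be an integer and let $z_1,\ldots,z_n$ be complex numbers with $|z_k|=1$ for all $k$. Put $S(\nu)=\sum_{k=1}^n z_k^\nu$. Then: (i) $\max_{\nu=1,\dots,n^2-n} |S(\nu)| \ge \sqrt{n-1}$; (ii) if equality holds in (i), i.e. $\max_{\nu=1,\dots,n^2-n} |S(\nu)| = \sqrt{n-1}$, then $|S(\nu)|=\sqrt{n-1}$ for every $\nu=1,\ldots,n^2-n$. *)

(* Defs.v *)
From mathcomp Require Export all_boot all_order all_algebra.
From mathcomp Require Export reals.
From mathcomp Require Export complex.

Set Implicit Arguments.
Unset Strict Implicit.
Unset Printing Implicit Defensive.

Import GRing.Theory Num.Theory.
Local Open Scope ring_scope.

Definition power_sum (R : realType) (n : nat) (z : 'I_n -> R[i]) (nu : nat) : R[i] :=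
  \sum_(k < n) z k ^+ nu.

(* [normc] is the modulus with values in [R], where the order is total
   ([`|_|] on [R[i]] has values in [R[i]]).  The default value 0 of the iterated
   maximum is harmless: moduli are nonnegative and the range is nonempty as soon
   as n >= 2. *)
Definition max_power_sum (R : realType) (n : nat) (z : 'I_n -> R[i]) : R :=
  \big[Num.max/0]_(1 <= nu < (n ^ 2 - n).+1) Normc.normc (power_sum z nu).

(* Main.v *)
Require Import Defs.
From mathcomp Require Import ring.

Set Implicit Arguments.
Unset Strict Implicit.
Unset Printing Implicit Defensive.

Import Order.TTheory GRing.Theory Num.Theory.
Local Open Scope ring_scope.

(** Expanding [|S(nu)|^2] gives [n + T(nu)], where [T(nu)] is the [nu]-th power
    sum of the [N = n^2 - n] quotients [z_j / z_k], [j <> k].  If all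
    [|S(nu)|^2 <= n - 1], then [T(nu) <= -1] for [1 <= nu <= N], and Newton's
    identities show inductively that the coefficients of [\prod (1 - w X)], [w]
    running over the quotients, are all at least 1.  The last coefficient is
    exactly 1, because the quotients come in inverse pairs, so every inequality
    in the last Newton identity is an equality and every [T(nu)] is [-1]. *)

(** The logarithmic derivative of the product is minus the sum of the [w / (1 - w X)]. Each
    geometric series is cut off at order [K] and the tails are collected in ['X^K * q], so the
    identity stays inside polynomials. *)
Lemma newton_deriv (C : comNzRingType) (s : seq C) (K : nat) :
  exists q : {poly C},
    (\prod_(w <- s) (1 - w *: 'X))^`() =
    'X^K * q - (\prod_(w <- s) (1 - w *: 'X))
               * \sum_(m < K) (\sum_(w <- s) w ^+ m.+1) *: 'X^m.
Proof.
elim: s => [|w s [q IHs]].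
  exists 0; rewrite !big_nil -[1]/(1%:P) derivC mulr0 sub0r.
  rewrite big1 ?mulr0 ?oppr0 //.
  by move=> m _; rewrite big_nil scale0r.
set P := \prod_(w <- s) _ in IHs *.
set G := \sum_(m < K) _ in IHs.
rewrite !big_cons -/P.
have -> : \sum_(m < K) (\sum_(u <- w :: s) u ^+ m.+1) *: 'X^m
        = \sum_(m < K) w *: (w *: 'X) ^+ m + G.
  rewrite -big_split /=; apply: eq_bigr => m _.
  by rewrite big_cons scalerDl exprZn scalerA -exprS.
have geom : (1 - w *: 'X) * (\sum_(m < K) w *: (w *: 'X) ^+ m)
            = w%:P * (1 - (w *: 'X) ^+ K).
  rewrite -scaler_sumr -scalerAr -[1 - _ ^+ K]opprB subrX1.
  by rewrite -mulNr opprB mul_polyC.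
(* The first summand is the tail of the geometric series of the new factor; the second is the old
   remainder times that factor. *)
exists (- (w ^+ K.+1) *: P + (1 - w *: 'X) * q).
rewrite derivM IHs derivB derivZ derivX -polyC1 derivC sub0r.
rewrite [X in _ = _ - X](_ : _ = P * (w%:P * (1 - (w *: 'X) ^+ K))
                                 + (1 - w *: 'X) * P * G); last first.
  by rewrite -geom polyC1; ring.
rewrite exprZn -!mul_polyC polyCN !rmorphXn exprS polyC1 /=; ring.
Qed.

Lemma newton_coef (C : comNzRingType) (s : seq C) (k : nat) :
  (\prod_(w <- s) (1 - w *: 'X))`_k.+1 *+ k.+1 =
  - \sum_(m < k.+1) (\sum_(w <- s) w ^+ m.+1)
                    * (\prod_(w <- s) (1 - w *: 'X))`_(k - m).
Proof.
(* With cut-off [k.+1] the remainder does not reach the coefficient of ['X^k]. *)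
have [q Dq] := newton_deriv s k.+1.
rewrite -coef_deriv Dq coefB coefXnM ltnSn sub0r mulrC coefM; congr (- _).
apply: eq_bigr => m _; congr (_ * _).
rewrite coef_sum (bigD1 m) //= coefZ coefXn eqxx mulr1.
rewrite [X in _ + X]big1 ?addr0 // => i neim.
by rewrite coefZ coefXn eq_sym (inj_eq val_inj) (negPf neim) mulr0.
Qed.

Lemma coef_size_prod_1subZX (C : comNzRingType) (s : seq C) :
  (\prod_(w <- s) (1 - w *: 'X))`_(size s) = \prod_(w <- s) - w.
Proof.
(* The size bound is carried through the induction because it makes the coefficient of the shorter
   product at [(size s).+1] vanish. *)
suff [_ //] : (size (\prod_(w <- s) (1 - w *: 'X))%R <= (size s).+1)%N
  /\ (\prod_(w <- s) (1 - w *: 'X))`_(size s) = \prod_(w <- s) - w.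
elim: s => [|w s [sz_s IHs]]; first by rewrite !big_nil size_poly1 coef1.
rewrite !big_cons; split.
  rewrite mulrBl mul1r -scalerAl (leq_trans (size_polyD _ _)) // geq_max.
  rewrite (leq_trans sz_s) //= size_polyN (leq_trans (size_scale_leq _ _)) //.
  by rewrite (leq_trans (size_polyMleq _ _)) // size_polyX.
rewrite mulrBl mul1r -scalerAl coefB coefZ coefXM /= IHs.
by rewrite nth_default ?sub0r ?mulNr.
Qed.

(** Each identity writes [a k.+1 *+ k.+1] as a sum of [k.+1] products of two factors that are at
    least 1. The order may be partial: [p nu <= -1] also forces [p nu] to be real. *)
Lemma newton_ge1_rigid (C : numDomainType) (N : nat) (a p : nat -> C) :
    a 0%N = 1 -> a N = 1 ->
    (forall k, a k.+1 *+ k.+1 = - \sum_(m < k.+1) p m.+1 * a (k - m)%N) ->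
    (forall nu, (1 <= nu <= N)%N -> p nu <= -1) ->
  forall nu, (1 <= nu <= N)%N -> p nu = -1.
Proof.
move=> a0 aN newton p_le.
have term_ge1 k (m : 'I_k.+1) : (k < N)%N -> 1 <= a (k - m)%N ->
    1 <= - p m.+1 * a (k - m)%N.
  move=> ltkN a_ge1; apply: mulr_ege1 => //.
  by rewrite lerNr p_le //= (leq_trans (ltn_ord m)).
have a_ge1 k : (k <= N)%N -> 1 <= a k.
  elim/ltn_ind: k => -[|k] IHk lekN; first by rewrite a0.
  rewrite -(@ler_pMn2r _ k.+1) // newton -sumrN.
  rewrite -[X in 1 *+ X]card_ord -sumr_const.
  apply: ler_sum => m _; rewrite -mulNr term_ge1 // IHk ?ltnS ?leq_subr //.
  by rewrite (leq_trans (leq_subr _ _)) // ltnW.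
case: N aN p_le term_ge1 a_ge1 => [|N] aN p_le term_ge1 a_ge1 [|nu] //= ltnuN.
(* The last coefficient is 1, so the excesses over 1 of the terms, all nonnegative, add up to 0. *)
have sum0 : \sum_(m < N.+1) (- p m.+1 * a (N - m)%N - 1) = 0.
  rewrite big_split /= sumr_const card_ord.
  under eq_bigr do rewrite mulNr.
  by rewrite sumrN -newton aN mulNrn subrr.
have aNm m : 1 <= a (N - m)%N by rewrite a_ge1 // (leq_trans (leq_subr _ _)).
have ge0 (m : 'I_N.+1) : true -> 0 <= - p m.+1 * a (N - m)%N - 1.
  by move=> _; rewrite subr_ge0 term_ge1.
have /eqP := psumr_eq0P ge0 sum0 (i := Ordinal ltnuN) isT.
(* A product equal to 1 whose second factor is at least 1 bounds its first factor [- p nu.+1] by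
   1. *)
rewrite subr_eq0 => /eqP /= eq1; apply/le_anti; rewrite p_le //= lerNl -eq1.
by rewrite ler_peMr // (le_trans ler01) // lerNr p_le.
Qed.

Lemma power_sums_le_N1 (C : numDomainType) (s : seq C) :
    \prod_(w <- s) - w = 1 ->
    (forall nu, (1 <= nu <= size s)%N -> \sum_(w <- s) w ^+ nu <= -1) ->
  forall nu, (1 <= nu <= size s)%N -> \sum_(w <- s) w ^+ nu = -1.
Proof.
move=> prod1; pose P := \prod_(w <- s) (1 - w *: 'X).
apply: (@newton_ge1_rigid _ _ (nth 0 P)).
- rewrite coef0_prod big1 // => w _.
  by rewrite coefB coefZ coefX coef1 mulr0 subr0.
- by rewrite coef_size_prod_1subZX.
- exact: newton_coef.
Qed.

(** A sequence, so that coinciding quotients keep their multiplicity. *)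
Definition quotients (C : unitRingType) (n : nat) (z : 'I_n -> C) : seq C :=
  [seq z p.1 / z p.2 | p : 'I_n * 'I_n in [pred p | p.1 != p.2]].

Lemma card_off_diagonal (n : nat) :
  #|[pred p : 'I_n * 'I_n | p.1 != p.2]| = (n ^ 2 - n)%N.
Proof.
have := cardC [pred p : 'I_n * 'I_n | p.1 == p.2].
rewrite card_prod card_ord.
have -> : #|[pred p : 'I_n * 'I_n | p.1 == p.2]| = n.
  rewrite -[RHS]card_ord -(card_codom (f := fun i : 'I_n => (i, i))).
  2: by move=> i j [].
  apply: eq_card => -[i j]; rewrite !inE /=.
  apply/eqP/codomP => [-> | [k [-> ->]]] //.
  by exists j.
by rewrite -mulnn => <-; rewrite addKn; apply: eq_card.
Qed.

Lemma size_quotients (C : unitRingType) (n : nat) (z : 'I_n -> C) :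
  size (quotients z) = (n ^ 2 - n)%N.
Proof. by rewrite size_image card_off_diagonal. Qed.

Lemma prod_opp_quotients (C : fieldType) (n : nat) (z : 'I_n -> C) :
  (forall k, z k != 0) -> \prod_(w <- quotients z) - w = 1.
Proof.
move=> z_neq0; rewrite big_image /= prodrN card_off_diagonal.
(* The exponent [n * (n - 1)] is even. *)
have -> : (-1) ^+ (n ^ 2 - n) = 1 :> C.
  rewrite -signr_odd -mulnn -[X in (_ - X)%N]muln1 -mulnBr oddM.
  by case: n {z z_neq0} => // n; rewrite subn1 /= andNb.
rewrite mul1r big_split /= prodfV.
(* Swapping the coordinates turns the product of the denominators into that of the numerators. *)
rewrite [X in _ / X](reindex_inj (h := fun p => (p.2, p.1))) /=; last first.
  by move=> [i j] [i' j'] [-> ->].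
under [X in _ / X]eq_bigl do rewrite inE /= eq_sym.
by rewrite divff // prodf_seq_neq0; apply/allP => p _; rewrite z_neq0 implybT.
Qed.

(** On the unit circle conjugation is inversion, so [S(nu)] times its conjugate is a double sum of
    powers of quotients, whose diagonal contributes [n]. *)
Lemma sum_quotients (C : numClosedFieldType) (n : nat) (z : 'I_n -> C)
    (nu : nat) : (forall k, `|z k| = 1) ->
  \sum_(w <- quotients z) w ^+ nu = `|\sum_k z k ^+ nu| ^+ 2 - n%:R.
Proof.
move=> z1; rewrite big_image /= normCK rmorph_sum mulr_suml /=.
under [X in _ = X - _]eq_bigr do rewrite mulr_sumr.
rewrite pair_big /= [X in _ = X - _](bigID (fun p => p.1 == p.2)) /=.
have z_inv k : (z k)^* = (z k)^-1 by rewrite invC_norm z1 expr1n invr1 mul1r.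
have -> : \sum_(p : 'I_n * 'I_n | p.1 == p.2) z p.1 ^+ nu * (z p.2 ^+ nu)^*
          = n%:R.
  rewrite -(pair_big_dep predT (fun i j => i == j)
             (fun i j => z i ^+ nu * (z j ^+ nu)^*)) /=.
  rewrite -[n in RHS]card_ord -sumr_const; apply: eq_bigr => i _.
  rewrite (big_pred1 i) => [|j]; last by rewrite eq_sym.
  by rewrite -normCK normrX z1 !expr1n.
rewrite addrAC subrr add0r; apply: eq_bigr => p _.
by rewrite rmorphXn /= z_inv exprMn.
Qed.

Lemma power_sum_rigid (R : realType) (n : nat) (z : 'I_n -> R[i]) :
    (forall k, Normc.normc (z k) = 1) ->
    (forall nu, (1 <= nu <= n ^ 2 - n)%N ->
       Normc.normc (power_sum z nu) ^+ 2 <= n%:R - 1) ->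
  forall nu, (1 <= nu <= n ^ 2 - n)%N ->
    Normc.normc (power_sum z nu) ^+ 2 = n%:R - 1.
Proof.
move=> hz S_le nu nu_int.
have normE (x : R[i]) : `|x| = (Normc.normc x)%:C%C by [].
have z1 k : `|z k| = 1 by rewrite normE hz.
have TE mu : \sum_(w <- quotients z) w ^+ mu
             = (Normc.normc (power_sum z mu) ^+ 2 - n%:R)%:C%C.
  by rewrite sum_quotients // normE rmorphB rmorphXn /= rmorph_nat.
have T_le mu : (1 <= mu <= size (quotients z))%N ->
    \sum_(w <- quotients z) w ^+ mu <= -1.
  rewrite size_quotients => /S_le S_le_mu.
  by rewrite TE -(rmorphN1 (real_complex R)) lecR lerBlDr addrC.
have prod1 : \prod_(w <- quotients z) - w = 1.
  by apply: prod_opp_quotients => k; rewrite -normr_eq0 z1 oner_eq0.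
have := power_sums_le_N1 prod1 T_le (nu := nu).
rewrite size_quotients => /(_ nu_int).
rewrite TE -(rmorphN1 (real_complex R)) => /complexI /eqP.
by rewrite subr_eq addrC => /eqP.
Qed.

Theorem lemma1 (R : realType) (n : nat) (z : 'I_n -> R[i])
    (hn : (2 <= n)%N) (hz : forall k : 'I_n, Normc.normc (z k) = 1) :
  Num.sqrt (n%:R - 1) <= max_power_sum z
  /\ (max_power_sum z = Num.sqrt (n%:R - 1) ->
      forall nu : nat, (1 <= nu <= n ^ 2 - n)%N ->
        Normc.normc (power_sum z nu) = Num.sqrt (n%:R - 1)).
Proof.
have n1_ge0 : 0 <= n%:R - 1 :> R by rewrite subr_ge0 ler1n ltnW.
have normc_ge0 (x : R[i]) : 0 <= Normc.normc x
  by case: x => a b; apply: sqrtr_ge0.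
have le_max nu : (1 <= nu <= n ^ 2 - n)%N ->
    Normc.normc (power_sum z nu) <= max_power_sum z.
  move=> nu_int; pose Snorm mu := Normc.normc (power_sum z mu).
  apply: (le_bigmax_seq 0 nu xpredT Snorm) => //.
  by rewrite mem_index_iota ltnS.
(* Assuming only an upper bound serves both parts: (ii) is the case of equality, and in (i) a
   strictly smaller maximum would contradict the value forced at [nu = 1]. *)
have rigid : max_power_sum z <= Num.sqrt (n%:R - 1) ->
    forall nu, (1 <= nu <= n ^ 2 - n)%N ->
      Normc.normc (power_sum z nu) = Num.sqrt (n%:R - 1).
  move=> max_le nu nu_int.
  rewrite -(power_sum_rigid hz _ nu_int) ?sqrtr_sqr ?ger0_norm // => mu mu_int.
  rewrite -[leRHS]sqr_sqrtr // ler_pXn2r ?nnegrE ?sqrtr_ge0 //.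
  exact: le_trans (le_max _ mu_int) max_le.
split=> [|max_eq]; last by apply: rigid; rewrite max_eq.
have int1 : (1 <= 1 <= n ^ 2 - n)%N.
  by rewrite subn_gt0 (@ltn_exp2l n 1 2).
rewrite leNgt; apply/negP => max_lt.
have := le_max _ int1; rewrite (rigid (ltW max_lt) _ int1).
by move=> /(lt_le_trans max_lt); rewrite ltxx.
Qed.
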